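(* Let $\mathcal{C}$ be a PCM-category and let $\mathcal{D}$ be a locally countable category. Then the Cauchy product $\mathcal{C}[\mathcal{D}]$ is a PCM-category. (In particular its composition is well defined, it is a category, and its partial summations on hom-sets satisfy the axioms of a PCM-category.)
   Context: ''Countable'' means finite (possibly empty) or denumerably infinite. For a set $M$ and a countable set $I$, an $I$-indexed family of elements of $M$ is a function $x: I\to M$, written $\{x_i\}_{i\in I}$. A partial commutative monoid (PCM) is a non-empty set $M$ with a partial function $\Sigma$ from countably indexed families of elements of $M$ to elements of $M$; a family is called summable when it is in the domain of $\Sigma$, and its image is written $\sum_{i\in I}x_i$. The axioms are: (Unary Sum) if $I=\{i'\}$ is a singleton, then $\{x_i\}_{i\in I}$ is summable and $\sum_{i\in I}x_i=x_{i'}$; (Weak Partition-Associativity) if $\{x_i\}_{i\in I}$ is summable and $\{I_j\}_{j\in J}$ is a countable partition of $I$ (countably many $I_j$ may be empty), then $\{x_i\}_{i\in I_j}$ is summable for every $j\in J$, $\{\sum_{i\in I_j}x_i\}_{j\in J}$ is summable, and $\sum_{i\in I}x_i=\sum_{j\in J}\left(\sum_{i\in I_j}x_i\right)$. A PCM-category is a locally small category $\mathcal{C}$ with, for all objects $X,Y$, a partial function $\Sigma^{(X,Y)}$ from countably indexed families over $\mathcal{C}(X,Y)$ to $\mathcal{C}(X,Y)$ such that (1) each $(\mathcal{C}(X,Y),\Sigma^{(X,Y)})$ is a PCM; (2) (strong distributivity) if $\{f_i\in\mathcal{C}(X,Y)\}_{i\in I}$ and $\{g_j\in\mathcal{C}(Y,Z)\}_{j\in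 J}$ are summable, then $\{g_jf_i\in\mathcal{C}(X,Z)\}_{(j,i)\in J\times I}$ is summable and $\sum_{(j,i)\in J\times I}g_jf_i=\left(\sum_{j\in J}g_j\right)\left(\sum_{i\in I}f_i\right)$. A category $\mathcal{D}$ is locally countable when every hom-set $\mathcal{D}(U,V)$ is countable. For a PCM-category $\mathcal{C}$ and a locally countable category $\mathcal{D}$, the Cauchy product $\mathcal{C}[\mathcal{D}]$ is given by the following data. Objects: $Ob(\mathcal{C})\times Ob(\mathcal{D})$. Arrows: $\mathcal{C}[\mathcal{D}]((X,U),(Y,V))$ is the set of all functions $f:\mathcal{D}(U,V)\to\mathcal{C}(X,Y)$ such that $\{f(a)\}_{a\in\mathcal{D}(U,V)}$ is a summable family. Composition: for $f\in\mathcal{C}[\mathcal{D}]((X,U),(Y,V))$ and $g\in\mathcal{C}[\mathcal{D}]((Y,V),(Z,W))$, the arrow $gf$ is the function $\mathcal{D}(U,W)\to\mathcal{C}(X,Z)$ with $(gf)(c)=\sum_{\{(b,a)\,:\,c=ba\}\subseteq\mathcal{D}(V,W)\times\mathcal{D}(U,V)}g(b)f(a)$. Identities: $1_{(X,U)}(r)=1_X$ if $r=1_U$, and $1_{(X,U)}(r)=0_{XX}$ (the sum of the empty family in $\mathcal{C}(X,X)$) otherwise. Summation: $\{f_i\in\mathcal{C}[\mathcal{D}]((X,U),(Y,V))\}_{i\in I}$ is summable exactly when $\{f_i(h)\in\mathcal{C}(X,Y)\}_{(i,h)\in I\times\mathcal{D}(U,V)}$ is summable in $\mathcal{C}$, in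 which case $\left(\sum_{i\in I}f_i\right)(h)=\sum_{i\in I}f_i(h)$. *)

(* Defs.v *)
From mathcomp Require Import all_boot.
From mathcomp Require Import boolp classical_sets functions cardinality.

Set Implicit Arguments.
Unset Strict Implicit.
Unset Printing Implicit Defensive.

Local Open Scope classical_set_scope.

(* A family of subsets of [I] indexed by [J], pairwise disjoint for distinct
   indices and covering [I].  Unlike in [classical_sets.partition], blocks may
   be empty. *)
Definition is_partition (I J : Type) (P : J -> set I) : Prop :=
  \bigcup_(j in [set: J]) P j = [set: I] /\ trivIset [set: J] P.

(* [psum x = Some s] means that the family [x] is summable with sum [s];
   [psum_countable] says that only countably indexed families are in the
   domain of the partial function. *)
Record pcm (M : Type) := Pcm {
  psum : forall I : Type, (I -> M) -> option M;
  psum_countable : forall (I : Type) (x : I -> M),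
    psum x -> countable [set: I];
  pcm_nonempty : inhabited M;
  psum_unary : forall (I : Type) (i' : I) (x : I -> M),
    (forall i : I, i = i') -> psum x = Some (x i');
  psum_partition : forall (I J : Type) (x : I -> M) (P : J -> set I) (s : M),
    psum x = Some s ->
    countable [set: J] -> is_partition P ->
    exists y : J -> M,
      (forall j : J, psum (fun i : set_type (P j) => x (val i)) = Some (y j))
      /\ psum y = Some s
}.

Definition summable (M : Type) (S : pcm M) (I : Type) (x : I -> M) : bool :=
  isSome (psum S x).

(* [compose g f] is the composite written [gf]: first [f], then [g]. *)
Record category (ob : Type) (hom : ob -> ob -> Type) := Category {
  ident : forall X : ob, hom X X;
  compose : forall X Y Z : ob, hom Y Z -> hom X Y -> hom X Z;
  compose_idl : forall (X Y : ob) (f : hom X Y), compose (ident Y) f = f;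
  compose_idr : forall (X Y : ob) (f : hom X Y), compose f (ident X) = f;
  composeA : forall (X Y Z W : ob) (h : hom Z W) (g : hom Y Z) (f : hom X Y),
    compose h (compose g f) = compose (compose h g) f
}.

Definition locally_countable (ob : Type) (hom : ob -> ob -> Type)
    (D : category hom) : Prop :=
  forall U V : ob, countable [set: hom U V].

Record pcm_category (ob : Type) (hom : ob -> ob -> Type) := PcmCategory {
  pcm_cat :> category hom;
  hom_pcm : forall X Y : ob, pcm (hom X Y);
  strong_distributivity : forall (X Y Z : ob) (I J : Type)
      (f : I -> hom X Y) (g : J -> hom Y Z) (s : hom X Y) (t : hom Y Z),
    psum (hom_pcm X Y) f = Some s ->
    psum (hom_pcm Y Z) g = Some t ->
    psum (hom_pcm X Z) (fun p : J * I => compose pcm_cat (g p.1) (f p.2))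
      = Some (compose pcm_cat t s)
}.

Section CauchyProduct.

Variables (obC : Type) (homC : obC -> obC -> Type) (C : pcm_category homC).
Variables (obD : Type) (homD : obD -> obD -> Type) (D : category homD).

Definition cauchy_hom (A B : obC * obD) : Type :=
  {f : homD A.2 B.2 -> homC A.1 B.1 | summable (hom_pcm C A.1 B.1) f}.

(* The pairs [(b, a)] with [ba = c]. *)
Definition factorizations (U V W : obD) (c : homD U W) :
    set (homD V W * homD U V) :=
  [set p | compose D p.1 p.2 = c].

(* The pcm-category structure [E] on the objects [obC * obD] and arrows
   [cauchy_hom] has the composition, identities and summation of the Cauchy
   product.  These clauses determine all the data of [E]; that they are
   well defined is part of the existence of such an [E].  In [cauchy_summable]
   the index set [I] has to be assumed countable: when [homD A.2 B.2] is empty,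
   so is [I * homD A.2 B.2], whatever [I] is. *)
Record is_cauchy_product (E : pcm_category cauchy_hom) : Prop := {
  cauchy_compose : forall (A B G : obC * obD)
      (f : cauchy_hom A B) (g : cauchy_hom B G) (c : homD A.2 G.2),
    psum (hom_pcm C A.1 G.1)
      (fun p : set_type (@factorizations A.2 B.2 G.2 c) =>
         compose C (sval g (val p).1) (sval f (val p).2))
      = Some (sval (compose E g f) c);
  cauchy_ident1 : forall A : obC * obD,
    sval (ident E A) (ident D A.2) = ident C A.1;
  cauchy_ident0 : forall (A : obC * obD) (r : homD A.2 A.2),
    r <> ident D A.2 ->
    psum (hom_pcm C A.1 A.1) (of_void (homC A.1 A.1))
      = Some (sval (ident E A) r);
  cauchy_summable : forall (A B : obC * obD) (I : Type)
      (F : I -> cauchy_hom A B),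
    countable [set: I] ->
    summable (hom_pcm E A B) F <->
    summable (hom_pcm C A.1 B.1)
      (fun p : I * homD A.2 B.2 => sval (F p.1) p.2);
  cauchy_sum : forall (A B : obC * obD) (I : Type)
      (F : I -> cauchy_hom A B) (s : cauchy_hom A B),
    psum (hom_pcm E A B) F = Some s ->
    forall h : homD A.2 B.2,
      psum (hom_pcm C A.1 B.1) (fun i : I => sval (F i) h) = Some (sval s h)
}.

End CauchyProduct.

(* Main.v *)
Require Import Defs.
From mathcomp Require Import all_boot.
From mathcomp Require Import boolp classical_sets cardinality.

Set Implicit Arguments.
Unset Strict Implicit.
Unset Printing Implicit Defensive.

Local Open Scope classical_set_scope.

(** Everything rests on one consequence of partition-associativity
    ([psum_fibers]): a summable family may be grouped along the fibers of any
    map [phi] into a countable type, and the family of group sums is again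
    summable with the same sum.  Every law of the Cauchy product follows by
    exhibiting one summable family of the base category and grouping it in one
    or two ways.

    - If [f] and [g] are arrows of the Cauchy product, strong distributivity
      makes the family of all [g b * f a] summable; grouping it by the
      composite [b a] shows that all the convolution sums exist and that the
      convolution is again a summable family.
    - Associativity compares two groupings of the summable family of all
      [h c * (g b * f a)] with [c b a = d], by the pairs [(c, ba)] and by the
      pairs [(cb, a)].  The identity laws hold because a family that vanishes
      away from one index has its value there as sum ([psum_delta]).
    - A family [F] of arrows is summable when its joint family
      [(i, a) |-> F i a] is.  Grouping the joint family by [a] gives the
      pointwise sums and shows that they form an arrow; grouping it by
      (block of [i], [a]) gives partition-associativity.
    - For strong distributivity, the joint families of [f] and [g] have a
      summable product family [g j b * f i a].  Grouped by
      [((j, i), ba)] it shows that the composites [g j * f i] are jointly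
      summable.  Its part over [ba = c], grouped by [(j, i)] and by [(b, a)],
      has as sum the value at [c] of the sum of the composites and the value at
      [c] of the composite of the sums. *)

(** * Sums in a partial commutative monoid *)

Lemma countable_inj (A B : Type) (f : A -> B) :
  injective f -> countable [set: B] -> countable [set: A].
Proof.
move=> finj /countable_injP[g ginj]; apply/countable_injP.
by exists (g \o f) => a b _ _ /= /ginj; rewrite !in_setE => /(_ I I) /finj.
Qed.

Section Sums.
Variables (M : Type) (S : pcm M).

Lemma countable_index (I : Type) (x : I -> M) (s : M) :
  psum S x = Some s -> countable [set: I].
Proof. by move=> xs; apply: (psum_countable (p := S) (x := x)); rewrite xs. Qed.

(** Invariance under reindexing is partition-associativity for the partition
    of [I] into the singletons [[set e j]], whose sums the unary axiom gives. *)
Lemma psum_bij (I J : Type) (e : J -> I) (x : I -> M) (s : M) :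
  injective e -> (forall i, exists j, e j = i) ->
  psum S x = Some s -> psum S (x \o e) = Some s.
Proof.
move=> einj esurj xs.
have [||y [hy ys]] := psum_partition (P := fun j => [set e j]) xs.
- exact: countable_inj einj (countable_index xs).
- split; first by apply/seteqP; split=> // i _; have [j <-] := esurj i; exists j.
  by move=> j k _ _ [i [/= -> /einj]].
suff -> : x \o e = y by [].
apply/funext => j; apply: Some_inj; rewrite -hy.
have ej : e j \in [set e j] by apply/mem_set.
rewrite (psum_unary S (i' := exist _ (e j) ej)) //.
by move=> [i hi]; apply: val_inj; exact: (set_mem hi).
Qed.

(** Grouping along the fibers of [phi].  The type [K j], embedded by [e j],
    parametrizes the fiber over [j]; leaving its choice open avoids transporting
    families between subtypes in each application. *)
Lemma psum_fibers_ex (I J : Type) (K : J -> Type) (phi : I -> J)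
    (e : forall j, K j -> I) (x : I -> M) (s : M) :
  countable [set: J] -> (forall j, injective (e j)) ->
  (forall j k, phi (e j k) = j) -> (forall i, exists k, e (phi i) k = i) ->
  psum S x = Some s ->
  exists y : J -> M,
    (forall j, psum S (fun k => x (e j k)) = Some (y j)) /\ psum S y = Some s.
Proof.
move=> cJ einj phie esurj xs.
have [||y [hy ys]] := psum_partition (P := fun j => phi @^-1` [set j]) xs => //.
  split; first by apply/seteqP; split=> // i _; exists (phi i).
  by move=> j k _ _ [i [/= <- <-]].
exists y; split=> // j.
have ein k : e j k \in phi @^-1` [set j] by apply/mem_set.
apply: (psum_bij (e := fun k => exist _ (e j k) (ein k)) _ _ (hy j)).
  by move=> k l /(congr1 val) /einj.
move=> [i hi]; have := esurj i; have /= ij := set_mem hi.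
by rewrite ij => -[k ek]; exists k; apply: val_inj.
Qed.

Lemma psum_fibers (I J : Type) (K : J -> Type) (phi : I -> J)
    (e : forall j, K j -> I) (x : I -> M) (y : J -> M) (s : M) :
  countable [set: J] -> (forall j, injective (e j)) ->
  (forall j k, phi (e j k) = j) -> (forall i, exists k, e (phi i) k = i) ->
  (forall j, psum S (fun k => x (e j k)) = Some (y j)) ->
  psum S x = Some s -> psum S y = Some s.
Proof.
move=> cJ einj phie esurj hy xs.
have [z [hz <-]] := psum_fibers_ex cJ einj phie esurj xs.
by congr psum; apply/funext => j; apply: Some_inj; rewrite -hy.
Qed.

(** A subfamily is one block of the partition of [I] into the range of [e] and
    its complement. *)
Lemma psum_sub (I J : Type) (e : J -> I) (x : I -> M) (s : M) :
  injective e -> psum S x = Some s -> exists t, psum S (x \o e) = Some t.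
Proof.
move=> einj xs.
have [||y [hy _]] := psum_partition
  (P := fun b : bool => if b then range e else ~` range e) xs.
- exact: countableP.
- split; last by move=> [] [] // _ _ [i []].
  apply/seteqP; split=> // i _.
  by have [h|h] := pselect (range e i); [exists true|exists false].
exists (y true).
have ein j : e j \in range e by apply/mem_set; exists j.
apply: (psum_bij (e := fun j => exist _ (e j) (ein j)) _ _ (hy true)).
  by move=> j k /(congr1 val) /einj.
by move=> [i hi]; have [j _ ji] := set_mem hi; exists j; apply: val_inj.
Qed.

(** The empty family is a subfamily of a one-element family, which exists as
    [M] is not empty. *)
Lemma psum_void_ex : exists z, psum S (of_void M) = Some z.
Proof.
have [m] := pcm_nonempty S.
have ms : psum S (fun _ : unit => m) = Some m.
  by apply: (psum_unary S (i' := tt)) => -[].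
have [|t] := psum_sub (e := of_void unit) _ ms; first by case.
by rewrite (_ : _ \o _ = of_void M); [exists t|apply/funext; case].
Qed.

Definition pzero : M := sval (cid psum_void_ex).

Lemma psum_void : psum S (of_void M) = Some pzero.
Proof. exact: svalP (cid psum_void_ex). Qed.

Lemma psum_empty (I : Type) (x : I -> M) :
  (I -> False) -> psum S x = Some pzero.
Proof.
move=> I0.
rewrite (_ : x = of_void M \o (fun i => match I0 i with end)); last first.
  by apply/funext => i; case: (I0 i).
by apply: psum_bij psum_void => [i|[]]; case: (I0 i).
Qed.

(** A one-element family can be grouped along the map to [I] with value [i0]:
    the fiber over [i0] contributes [x i0] and the other fibers, being empty,
    contribute [pzero].  Thus zeros may be added to a family although the
    axioms do not mention a neutral element. *)
Lemma psum_delta (I : Type) (i0 : I) (x : I -> M) :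
  countable [set: I] -> (forall i, i <> i0 -> x i = pzero) ->
  psum S x = Some (x i0).
Proof.
move=> cI x0.
have x1 : psum S (fun _ : unit => x i0) = Some (x i0).
  by apply: (psum_unary S (i' := tt)) => -[].
apply: (psum_fibers (K := fun i => i = i0) (phi := fun=> i0) (e := fun _ _ => tt)
  cI _ _ _ _ x1) => //.
- by move=> i p q _; apply: Prop_irrelevance.
- by move=> [] /=; exists erefl.
move=> i; have [->|ni] := pselect (i = i0).
  by apply: (psum_unary S (i' := erefl)) => p; apply: Prop_irrelevance.
by rewrite (x0 i ni) psum_empty.
Qed.

Lemma psum_zero (I : Type) :
  countable [set: I] -> psum S (fun _ : I => pzero) = Some pzero.
Proof.
move=> cI; apply: (psum_fibers (K := fun=> void) (phi := of_void I)
  (e := fun=> of_void void) cI _ _ _ _ psum_void) => // _.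
  by case.
by apply: psum_empty; case.
Qed.

End Sums.

(** * Composition with a fixed arrow *)

Section SumsInPcmCategory.
Variables (ob : Type) (hom : ob -> ob -> Type) (C : pcm_category hom).
Variables (X Y Z : ob).

(** Strong distributivity for the one-element family [g]. *)
Lemma psum_composel (I : Type) (g : hom Y Z) (f : I -> hom X Y) (s : hom X Y) :
  psum (hom_pcm C X Y) f = Some s ->
  psum (hom_pcm C X Z) (fun i => compose C g (f i)) = Some (compose C g s).
Proof.
move=> fs.
have gg : psum (hom_pcm C Y Z) (fun _ : unit => g) = Some g.
  by apply: (psum_unary _ (i' := tt)) => -[].
apply: (psum_bij (e := fun i => (tt, i)) _ _ (strong_distributivity fs gg)).
  by move=> i j [].
by move=> [[] i]; exists i.
Qed.

Lemma psum_composer (J : Type) (g : J -> hom Y Z) (t : hom Y Z) (f : hom X Y) :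
  psum (hom_pcm C Y Z) g = Some t ->
  psum (hom_pcm C X Z) (fun j => compose C (g j) f) = Some (compose C t f).
Proof.
move=> gt.
have ff : psum (hom_pcm C X Y) (fun _ : unit => f) = Some f.
  by apply: (psum_unary _ (i' := tt)) => -[].
apply: (psum_bij (e := fun j => (j, tt)) _ _ (strong_distributivity ff gt)).
  by move=> i j [].
by move=> [j []]; exists j.
Qed.

(** An empty family composed with [f] is still empty, so distributivity
    forces its sum to absorb [f]. *)
Lemma compose0l (f : hom X Y) :
  compose C (pzero (hom_pcm C Y Z)) f = pzero (hom_pcm C X Z).
Proof.
apply: Some_inj; rewrite -(psum_composer f (psum_void _)).
by apply: psum_empty; case.
Qed.

Lemma compose0r (g : hom Y Z) :
  compose C g (pzero (hom_pcm C X Y)) = pzero (hom_pcm C X Z).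
Proof.
apply: Some_inj; rewrite -(psum_composel g (psum_void _)).
by apply: psum_empty; case.
Qed.

End SumsInPcmCategory.

(** * The category structure of the Cauchy product *)

Section Cauchy.
Variables (obC : Type) (homC : obC -> obC -> Type) (C : pcm_category homC).
Variables (obD : Type) (homD : obD -> obD -> Type) (D : category homD).
Hypothesis hD : locally_countable D.

Local Notation hom := (cauchy_hom C homD).
Local Notation facts V c := (set_type (@factorizations _ _ D _ V _ c)).
Local Notation Csum A B := (psum (hom_pcm C A.1 B.1)).

Lemma cauchy_hom_ext (A B : obC * obD) (f g : hom A B) :
  (forall a, sval f a = sval g a) -> f = g.
Proof. by move=> fg; apply: val_inj; apply/funext. Qed.

Lemma cauchy_hom_sum (A B : obC * obD) (f : hom A B) :
  exists s, Csum A B (sval f) = Some s.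
Proof. by case: f => f /=; rewrite /summable; case: psum => // s; exists s. Qed.

(** Produces an arrow together with the equation for its underlying function,
    so that its summability proof never appears in later goals. *)
Lemma cauchy_hom_of (A B : obC * obD) (f : homD A.2 B.2 -> homC A.1 B.1) s :
  Csum A B f = Some s -> exists k : hom A B, sval k = f.
Proof.
move=> fs; suff hf : summable (hom_pcm C A.1 B.1) f by exists (exist _ f hf).
by rewrite /summable fs.
Qed.

Definition factor (U V W : obD) (b : homD V W) (a : homD U V) (c : homD U W)
    (h : compose D b a = c) : facts V c :=
  exist _ (b, a) (mem_set h).

Lemma factorP (U V W : obD) (c : homD U W)
    (p : facts V c) :
  compose D (val p).1 (val p).2 = c.
Proof. by case: p => p hp; exact: (set_mem hp). Qed.

Lemma facts_inj (U V W : obD) (c : homD U W) (k l : facts V c) :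
  (val k).1 = (val l).1 -> (val k).2 = (val l).2 -> k = l.
Proof.
by move=> kl1 kl2; apply: val_inj;
  rewrite [LHS]surjective_pairing kl1 kl2 -surjective_pairing.
Qed.

Lemma countable_factorizations (U V W : obD) (c : homD U W) :
  countable [set: facts V c].
Proof.
apply: (countable_inj (f := val)) val_inj _.
by rewrite -setXTT; apply: countableX; exact: hD.
Qed.

Section Composition.
Variables A B G : obC * obD.

Definition is_convolution (g : hom B G) (f : hom A B) (k : hom A G) : Prop :=
  forall c, Csum A G (fun p : facts B.2 c =>
    compose C (sval g (val p).1) (sval f (val p).2)) = Some (sval k c).

(** The convolution is the family of group sums of the summable family
    [(b, a) |-> g b * f a] along composition, whence both the existence of each
    sum and the summability of the result. *)
Lemma convolution_ex (g : hom B G) (f : hom A B) :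
  exists k, is_convolution g f k.
Proof.
have [s fs] := cauchy_hom_sum f; have [t gt] := cauchy_hom_sum g.
have [|||y [hy ys]] := psum_fibers_ex (J := homD A.2 G.2)
    (K := fun c => facts B.2 c)
    (phi := fun p => compose D p.1 p.2) (e := fun c => val)
    (hD A.2 G.2) _ _ _ (strong_distributivity fs gt).
- by move=> c; exact: val_inj.
- by move=> c p; exact: factorP.
- by move=> [b a]; exists (factor (erefl (compose D b a))).
by have [k ky] := cauchy_hom_of ys; exists k => c; rewrite ky; exact: hy.
Qed.

Definition cauchy_comp (g : hom B G) (f : hom A B) : hom A G :=
  sval (cid (convolution_ex g f)).

Lemma cauchy_compP (g : hom B G) (f : hom A B) :
  is_convolution g f (cauchy_comp g f).
Proof. exact: svalP (cid (convolution_ex g f)). Qed.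

Lemma convolution_unique (g : hom B G) (f : hom A B) k :
  is_convolution g f k -> cauchy_comp g f = k.
Proof.
move=> hk; apply: cauchy_hom_ext => c; apply: Some_inj.
by rewrite -hk; rewrite -cauchy_compP.
Qed.

End Composition.

Lemma cauchy_id_ex (A : obC * obD) : exists k : hom A A,
  sval k (ident D A.2) = ident C A.1 /\
  forall r, r <> ident D A.2 -> sval k r = pzero (hom_pcm C A.1 A.1).
Proof.
pose f r := if pselect (r = ident D A.2) then ident C A.1
            else pzero (hom_pcm C A.1 A.1).
have f0 r : r <> ident D A.2 -> f r = pzero (hom_pcm C A.1 A.1).
  by rewrite /f; case: pselect.
have [k kf] := cauchy_hom_of (psum_delta (hD A.2 A.2) f0).
by exists k; rewrite kf; split=> //; rewrite /f; case: pselect.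
Qed.

Definition cauchy_id (A : obC * obD) : hom A A := sval (cid (cauchy_id_ex A)).

Lemma cauchy_id1 (A : obC * obD) :
  sval (cauchy_id A) (ident D A.2) = ident C A.1.
Proof. by case: (svalP (cid (cauchy_id_ex A))). Qed.

Lemma cauchy_id0 (A : obC * obD) r : r <> ident D A.2 ->
  sval (cauchy_id A) r = pzero (hom_pcm C A.1 A.1).
Proof. by case: (svalP (cid (cauchy_id_ex A))) => _; exact. Qed.

(** In the convolution at [c], the identity vanishes on every factorization
    [(b, a)] except [(1, c)]. *)
Lemma cauchy_idl (A B : obC * obD) (f : hom A B) :
  cauchy_comp (cauchy_id B) f = f.
Proof.
apply: convolution_unique => c.
pose i0 := factor (compose_idl D c).
rewrite (psum_delta (i0 := i0)); first by rewrite /= cauchy_id1 compose_idl.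
  exact: countable_factorizations.
move=> p pi0; rewrite cauchy_id0 ?compose0l // => p1.
apply: pi0; apply: val_inj; have := factorP p; move: (val p) p1 => [b a] /= ->.
by rewrite compose_idl => ->.
Qed.

Lemma cauchy_idr (A B : obC * obD) (f : hom A B) :
  cauchy_comp f (cauchy_id A) = f.
Proof.
apply: convolution_unique => c.
pose i0 := factor (compose_idr D c).
rewrite (psum_delta (i0 := i0)); first by rewrite /= cauchy_id1 compose_idr.
  exact: countable_factorizations.
move=> p pi0; rewrite cauchy_id0 ?compose0r // => p1.
apply: pi0; apply: val_inj; have := factorP p; move: (val p) p1 => [b a] /= ->.
by rewrite compose_idr => ->.
Qed.

(** Both sides are the sum [s] of the same family over the triples
    [(c, b, a)] with composite [d]. *)
Lemma cauchy_compA (A B G H : obC * obD)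
    (h : hom G H) (g : hom B G) (f : hom A B) :
  cauchy_comp h (cauchy_comp g f) = cauchy_comp (cauchy_comp h g) f.
Proof.
apply: convolution_unique => d.
have [sf fs] := cauchy_hom_sum f; have [sg gs] := cauchy_hom_sum g.
have [sh hs] := cauchy_hom_sum h.
have gf := strong_distributivity fs gs.
have hgf := strong_distributivity gf hs.
pose T := set_type [set p : homD G.2 H.2 * (homD B.2 G.2 * homD A.2 B.2) |
  compose D p.1 (compose D p.2.1 p.2.2) = d].
have [s xs] := psum_sub (e := (val : T -> _)) val_inj hgf.
have TP (p : T) :
    compose D (val p).1 (compose D (val p).2.1 (val p).2.2) = d.
  by case: p => p hp; exact: (set_mem hp).
pose triple c b a (e : compose D c (compose D b a) = d) : T :=
  exist _ (c, (b, a)) (mem_set e).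
have eL (j : facts G.2 d)
    (k : facts B.2 (val j).2) :
    compose D (val j).1 (compose D (val k).1 (val k).2) = d.
  by rewrite factorP factorP.
have eR (j : facts B.2 d)
    (k : facts G.2 (val j).1) :
    compose D (val k).1 (compose D (val k).2 (val j).2) = d.
  by rewrite composeA factorP factorP.
(* The fiber over [(c, e)] consists of the factorizations [(b, a)] of [e]. *)
have L : psum (hom_pcm C A.1 H.1)
    (fun j : facts G.2 d =>
       compose C (sval h (val j).1) (sval (cauchy_comp g f) (val j).2))
    = Some s.
  apply: (psum_fibers (phi := fun p : T => factor (TP p))
    (e := fun j k => triple _ _ _ (eL j k)) _ _ _ _ _ xs) => [|j|j k|p|j].
  - exact: countable_factorizations.
  - by move=> k l /(congr1 val) [kl1 kl2]; exact: facts_inj kl1 kl2.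
  - by apply: val_inj; rewrite /= factorP -surjective_pairing.
  - exists (factor (erefl : compose D (val p).2.1 (val p).2.2 = _)).
    by apply: val_inj => /=; rewrite -!surjective_pairing.
  - exact: (psum_composel (sval h (val j).1) (cauchy_compP g f (val j).2)).
rewrite -[RHS]cauchy_compP L; symmetry.
(* The fiber over [(e, a)] consists of the factorizations [(c, b)] of [e]. *)
have TP' (p : T) := etrans (esym (composeA _ _ _ _)) (TP p).
apply: (psum_fibers (phi := fun p : T => factor (TP' p))
    (e := fun j k => triple _ _ _ (eR j k)) _ _ _ _ _ xs) => [|j|j k|p|j].
- exact: countable_factorizations.
- by move=> k l /(congr1 val) [kl1 kl2]; exact: facts_inj kl1 kl2.
- by apply: val_inj; rewrite /= factorP -surjective_pairing.
- exists (factor (erefl : compose D (val p).1 (val p).2.1 = _)).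
  by apply: val_inj => /=; rewrite -!surjective_pairing.
- have := psum_composer (sval f (val j).2) (cauchy_compP h g (val j).1).
  by move=> <-; congr psum; apply/funext => k; exact: composeA.
Qed.

Definition cauchy_category : category hom :=
  Category cauchy_idl cauchy_idr cauchy_compA.

(** * Summation in the Cauchy product *)

Section Summation.
Variables A B : obC * obD.

(** The pointwise sums are the group sums of the joint family along [snd];
    being a family of group sums, they are summable and so form an arrow. *)
Lemma pointwise_sum_ex (I : Type) (F : I -> hom A B) s :
  Csum A B (fun p : I * homD A.2 B.2 => sval (F p.1) p.2) = Some s ->
  exists k : hom A B,
    forall a, Csum A B (fun i => sval (F i) a) = Some (sval k a).
Proof.
move=> Fs.
have [|||y [hy ys]] := psum_fibers_ex (phi := snd) (K := fun=> I)
  (e := fun a i => (i, a)) (hD A.2 B.2) _ _ _ Fs => //.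
- by move=> a i j [].
- by move=> [i a]; exists i.
by have [k ky] := cauchy_hom_of ys; exists k => a; rewrite ky; exact: hy.
Qed.

(** Countability of [I] is not implied by joint summability: if
    [homD A.2 B.2] is empty, so is the index type of the joint family. *)
Definition is_cauchy_sum (I : Type) (F : I -> hom A B) (k : hom A B) : Prop :=
  [/\ countable [set: I],
      summable (hom_pcm C A.1 B.1)
        (fun p : I * homD A.2 B.2 => sval (F p.1) p.2) &
      forall a, Csum A B (fun i => sval (F i) a) = Some (sval k a)].

Definition cauchy_psum (I : Type) (F : I -> hom A B) : option (hom A B) :=
  if pselect (exists k, is_cauchy_sum F k) is left e then Some (sval (cid e))
  else None.

Lemma cauchy_psumP (I : Type) (F : I -> hom A B) k :
  cauchy_psum F = Some k <-> is_cauchy_sum F k.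
Proof.
rewrite /cauchy_psum; case: pselect => [e|ne]; last first.
  by split=> // Fk; case: ne; exists k.
case: cid => l /= Fl; split=> [[<-] //|Fk]; congr Some.
apply: cauchy_hom_ext => a; apply: Some_inj.
by case: Fl => _ _ <-; case: Fk => _ _ <-.
Qed.

Lemma is_cauchy_sum_joint (I : Type) (F : I -> hom A B) s :
  countable [set: I] ->
  Csum A B (fun p : I * homD A.2 B.2 => sval (F p.1) p.2) = Some s ->
  exists k, is_cauchy_sum F k.
Proof.
move=> cI Fs; have [k Fk] := pointwise_sum_ex Fs.
by exists k; split=> //; rewrite /summable Fs.
Qed.

Lemma cauchy_psum_countable (I : Type) (F : I -> hom A B) :
  cauchy_psum F -> countable [set: I].
Proof.
by rewrite /cauchy_psum; case: pselect => // -[k []].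
Qed.

Lemma cauchy_hom_nonempty : inhabited (hom A B).
Proof.
by have [k _] := cauchy_hom_of (psum_zero (hom_pcm C A.1 B.1) (hD A.2 B.2)).
Qed.

Lemma cauchy_psum_unary (I : Type) (i' : I) (F : I -> hom A B) :
  (forall i, i = i') -> cauchy_psum F = Some (F i').
Proof.
move=> I1; apply/cauchy_psumP; split.
- apply: (countable_inj (f := fun=> tt)); last exact: countableP.
  by move=> i j _; rewrite (I1 i) (I1 j).
- have [s Fs] := cauchy_hom_sum (F i').
  rewrite /summable (_ : (fun p => _) = sval (F i') \o snd); last first.
    by apply/funext => -[i a] /=; rewrite (I1 i).
  rewrite (psum_bij _ _ Fs) //; last by move=> a; exists (i', a).
  by move=> [i a] [j b] /= ->; rewrite (I1 i) (I1 j).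
- by move=> a; exact: (psum_unary (hom_pcm C A.1 B.1) (fun i => sval (F i) a)).
Qed.

(** Each block is a subfamily, hence jointly summable.  The joint family of the
    block sums arises from that of [F] by grouping along
    [(i, a) |-> (block of i, a)], and at each [a] the value of the sum is
    unchanged by partition-associativity for [i |-> F i a]. *)
Lemma cauchy_psum_partition (I J : Type) (F : I -> hom A B) (P : J -> set I) s :
  cauchy_psum F = Some s -> countable [set: J] -> is_partition P ->
  exists y : J -> hom A B,
    (forall j, cauchy_psum (fun i : set_type (P j) => F (val i)) = Some (y j))
    /\ cauchy_psum y = Some s.
Proof.
move=> /cauchy_psumP[cI Fs sE] cJ [Pcov Ptriv].
move: Fs; rewrite /summable; case Fs: psum => [t|] // _.
have blockP i : exists j, P j i.
  by have : [set: I] i by []; rewrite -Pcov => -[j _ Pji]; exists j.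
pose blk i := sval (cid (blockP i)).
have blkP i : P (blk i) i := svalP (cid (blockP i)).
have blkE j i : P j i -> blk i = j.
  by move=> Pji; apply: Ptriv => //; exists i; split.
have valE j (i : set_type (P j)) : blk (val i) = j.
  by apply: blkE; case: i => i hi; exact: (set_mem hi).
have /choice[y yE] j : exists k : hom A B,
    is_cauchy_sum (fun i : set_type (P j) => F (val i)) k.
  have [|u Fu] := psum_sub
      (e := fun p : set_type (P j) * homD A.2 B.2 => (val p.1, p.2)) _ Fs.
    by move=> [i a] [i' a'] [/val_inj -> ->].
  by apply: (is_cauchy_sum_joint _ Fu); apply: countable_inj cI; exact: val_inj.
exists y; split=> [j|]; first exact/cauchy_psumP.
apply/cauchy_psumP; split=> // [|a].
  rewrite /summable (psum_fibers (K := fun q => set_type (P q.1))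
    (phi := fun p : I * homD A.2 B.2 => (blk p.1, p.2))
    (e := fun q i => (val i, q.2)) _ _ _ _ _ Fs) // => [|q|q i|[i a]|q].
  - by rewrite -setXTT; apply: countableX => //; exact: hD.
  - by move=> i i' [/val_inj].
  - by rewrite /= valE -surjective_pairing.
  - by exists (exist _ i (mem_set (blkP i))).
  - by have [_ _ ->] := yE q.1.
apply: (psum_fibers (K := fun j => set_type (P j)) (phi := blk)
  (e := fun j => val) cJ _ _ _ _ (sE a)) => [j|j i|i|j].
- exact: val_inj.
- exact: valE.
- by exists (exist _ i (mem_set (blkP i))).
- by have [_ _ ->] := yE j.
Qed.

Definition cauchy_pcm : pcm (hom A B) :=
  Pcm cauchy_psum_countable cauchy_hom_nonempty cauchy_psum_unary
    cauchy_psum_partition.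

End Summation.

(** * Strong distributivity *)

Lemma cauchy_distributivity (A B G : obC * obD) (I J : Type)
    (f : I -> hom A B) (g : J -> hom B G) (s : hom A B) (t : hom B G) :
  cauchy_psum f = Some s -> cauchy_psum g = Some t ->
  cauchy_psum (fun p : J * I => cauchy_comp (g p.1) (f p.2))
    = Some (cauchy_comp t s).
Proof.
move=> /cauchy_psumP[cI fs sE] /cauchy_psumP[cJ gt tE].
move: fs gt; rewrite /summable.
case fs: psum => [sf|] // _; case gt: psum => [tg|] // _.
have gf := strong_distributivity fs gt.
have cJI : countable [set: J * I] by rewrite -setXTT; apply: countableX.
apply/cauchy_psumP; split=> // [|c].
  (* Group all products by [((j, i), ba)]. *)
  rewrite /summable (psum_fibers
    (K := fun q => facts B.2 q.2)
    (phi := fun p => ((p.1.1, p.2.1), compose D p.1.2 p.2.2))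
    (e := fun q k => ((q.1.1, (val k).1), (q.1.2, (val k).2)))
    _ _ _ _ _ gf) // => [|q|q k|[[j b] [i a]]|q].
  - by rewrite -setXTT; apply: countableX => //; exact: hD.
  - by move=> k l [kl1 kl2]; exact: facts_inj kl1 kl2.
  - by rewrite /= factorP -!surjective_pairing.
  - by exists (factor (erefl (compose D b a))).
  - exact: (cauchy_compP (g q.1.1) (f q.1.2) q.2).
(* The products with [ba = c], to be grouped by [(j, i)] and then by [(b, a)]. *)
pose T := ((J * I) * facts B.2 c)%type.
have [|u xu] := psum_sub (e := fun r : T =>
    ((r.1.1, (val r.2).1), (r.1.2, (val r.2).2))) _ gf.
  move=> [[j i] k] [[j' i'] l] [-> kl1 -> kl2].
  by rewrite (facts_inj kl1 kl2).
have -> : Csum A G (fun p : J * I => sval (cauchy_comp (g p.1) (f p.2)) c)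
    = Some u.
  apply: (psum_fibers (phi := fst) (e := fun p k => (p, k))
    cJI _ _ _ _ xu) => // [p k l []|[p k]|p] //; first by exists k.
  exact: (cauchy_compP (g p.1) (f p.2) c).
rewrite -cauchy_compP; symmetry.
apply: (psum_fibers (phi := snd) (e := fun k p => (p, k)) _ _ _ _ _ xu)
  => // [|k p q []|[p k]|k] //.
- exact: countable_factorizations.
- by exists p.
- exact: (strong_distributivity (sE (val k).2) (tE (val k).1)).
Qed.

Definition cauchy_pcm_category : pcm_category hom :=
  @PcmCategory _ _ cauchy_category cauchy_pcm cauchy_distributivity.

End Cauchy.

Theorem theorem4p3
  (obC : Type) (homC : obC -> obC -> Type) (C : pcm_category homC)
  (obD : Type) (homD : obD -> obD -> Type) (D : category homD)
  (hD : locally_countable D) :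
  exists E : pcm_category (cauchy_hom C homD), is_cauchy_product D E.
Proof.
exists (cauchy_pcm_category C hD); split=> /=.
- by move=> A B G f g; exact: cauchy_compP.
- exact: cauchy_id1.
- by move=> A r r1; rewrite cauchy_id0 // psum_void.
- move=> A B I F cI; split.
    rewrite {1}/summable /=; case Fk: cauchy_psum => [k|] // _.
    by have /cauchy_psumP[] := Fk.
  rewrite {1}/summable; case Fs: psum => [s|] // _.
  have [k Fk] := is_cauchy_sum_joint hD cI Fs.
  by have /cauchy_psumP Fk' := Fk; rewrite /summable /= Fk'.
- by move=> A B I F s /cauchy_psumP[].
Qed.
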